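(* Let $\mathcal{G}(\mathcal{V},\mathcal{E})$ be a chordal graph with $\mathcal{V}=\{1,\dots,r\}$ and maximal cliques $\{\mathcal{C}_1,\mathcal{C}_2,\ldots,\mathcal{C}_t\}$. Then $P(x)\in\widetilde{\Sigma}_{n,2d}^r(\mathcal{E},0)$ if and only if there exist SOS matrices $P_k(x)\in\Sigma_{n,2d}^{|\mathcal{C}_k|}$, $k=1,\ldots,t$, such that $$P(x)=\sum_{k=1}^{t}E_{\mathcal{C}_k}^{\mathsf T}P_k(x)E_{\mathcal{C}_k}.$$ Here $\widetilde{\Sigma}_{n,2d}^r(\mathcal{E},0)$ is the set of those $P(x)\in\Sigma_{n,2d}^r(\mathcal{E},0)$ that admit a Gram matrix $Q\succeq 0$ with $Q_{ij}=0$ when $p_{ij}(x)=0$, where $Q_{ij}$ is the $(i,j)$-th $N\times N$ block of $Q$ and $p_{ij}(x)$ is the $(i,j)$-th entry of $P(x)$.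
   Context: Graphs. $\mathcal{G}(\mathcal{V},\mathcal{E})$ is an undirected graph with node set $\mathcal{V}=\{1,\dots,r\}$ and edge set $\mathcal{E}\subseteq\mathcal{V}\times\mathcal{V}$, where $(i,j)\in\mathcal{E}\Leftrightarrow(j,i)\in\mathcal{E}$. It is chordal if every cycle of length at least four has a chord (an edge joining two nonconsecutive nodes of the cycle). A clique is a subset $\mathcal{C}\subseteq\mathcal{V}$ with $(i,j)\in\mathcal{E}$ for all $i,j\in\mathcal{C}$, $i\ne j$; it is maximal if it is not a subset of any other clique. Put $\mathcal{E}^*=\mathcal{E}\cup\{(i,i): i\in\mathcal{V}\}$. Index matrices. For a maximal clique $\mathcal{C}_k$, let $|\mathcal{C}_k|$ be its number of nodes and $\mathcal{C}_k(i)$ its $i$-th node in the natural ordering. The matrix $E_{\mathcal{C}_k}\in\mathbb{R}^{|\mathcal{C}_k|\times r}$ is defined by $(E_{\mathcal{C}_k})_{ij}=1$ if $\mathcal{C}_k(i)=j$ and $0$ otherwise. SOS matrices. $\mathbb{R}[x]_{n,m}$ is the set of real polynomials in $n$ variables $x=(x_1,\dots,x_n)$ of degree at most $m$, and $\mathbb{R}[x]_{n,m}^{q\times s}$ is the set of $q\times s$ matrices with entries in $\mathbb{R}[x]_{n,m}$. A symmetric $P(x)\in\mathbb{R}[x]_{n,2d}^{q\times q}$ is an SOS matrix if there exists a polynomial matrix $M(x)\in\mathbb{R}[x]_{n,d}^{s\times q}$ (for some $s$) with $P(x)=M(x)^{\mathsf T}M(x)$. The set of $q\times q$ SOS matrices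 with entries in $\mathbb{R}[x]_{n,2d}$ is denoted $\Sigma_{n,2d}^{q}$. Gram matrices. Let $N=\binom{n+d}{d}$ and let $v_d(x)=[1,x_1,\ldots,x_n,x_1^2,x_1x_2,\ldots,x_n^d]^{\mathsf T}$ be the vector of all $N$ monomials of degree at most $d$. It is known that $P(x)\in\Sigma_{n,2d}^q$ if and only if there is a symmetric positive semidefinite $qN\times qN$ real matrix $Q$ with $P(x)=(I_q\otimes v_d(x))^{\mathsf T}Q\,(I_q\otimes v_d(x))$; such a $Q$ is called a Gram matrix of $P(x)$ and is usually not unique. Partitioning $Q$ into $N\times N$ blocks $Q_{ij}$, one has $p_{ij}(x)=v_d(x)^{\mathsf T}Q_{ij}v_d(x)$ for $i,j=1,\dots,q$. Sparse SOS matrices. $\Sigma_{n,2d}^r(\mathcal{E},0)$ is the set of $P(x)\in\Sigma_{n,2d}^r$ such that $p_{ij}(x)=p_{ji}(x)=0$ (identically) whenever $(i,j)\notin\mathcal{E}^*$.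
   Formalization: The condition ''Q_ij = 0 when p_ij(x) = 0'' is imposed only for (i,j) outside E*, not for entries inside the pattern that happen to vanish; read literally the ''if'' direction fails, e.g. E complete on 3 nodes, P = M^T M, M = [[1,1,x],[x,1,-1]]. *)

(* Defs.v *)
From mathcomp Require Import all_boot all_order all_algebra.
From mathcomp Require Import reals.
From mathcomp Require Import mpoly mxtens.

Set Implicit Arguments.
Unset Strict Implicit.
Unset Printing Implicit Defensive.

Import Order.TTheory GRing.Theory Num.Theory.
Local Open Scope ring_scope.

(* Graphs on the node set {1, ..., r}, represented by 'I_r.  An edge set is a *)
(* symmetric relation; self-loops are neither required nor excluded, and none *)
(* of the notions below depends on them.                                      *)
Section Graphs.
Variables (r : nat) (E : rel 'I_r).

(* E^* = E together with all the pairs (i, i) *)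
Definition edge_star : rel 'I_r := [rel i j | (i == j) || E i j].

Definition clique (C : {set 'I_r}) : bool :=
  [forall i in C, forall j in C, (i != j) ==> E i j].

Definition maximal_clique (C : {set 'I_r}) : bool := maxset clique C.

(* [ucycle E c] is a cycle through pairwise distinct nodes; [x] and [y] are   *)
(* consecutive in it iff one is the cyclic successor of the other.            *)
Definition chordal : Prop :=
  forall c : seq 'I_r, ucycle E c -> (4 <= size c)%N ->
  exists x y : 'I_r,
    [&& x \in c, y \in c, x != y, next c x != y, next c y != x & E x y].

End Graphs.

(* [enum_val] lists C in increasing order, so [enum_val i] is C(i). *)
Definition index_mx (A : nzRingType) (r : nat) (C : {set 'I_r}) :
    'M[A]_(#|C|, r) :=
  \matrix_(i < #|C|, j < r) (enum_val i == j)%:R.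

Section SOS.
Variables (R : realType) (n : nat).

(* [msize p] is 1 + the total degree of p, and 0 for p = 0. *)
Definition mxdeg_le (m q s : nat) (P : 'M[{mpoly R[n]}]_(q, s)) : Prop :=
  forall i j, (msize (P i j) <= m.+1)%N.

(* P is in Sigma_{n,2d}^q *)
Definition sos_mx (d q : nat) (P : 'M[{mpoly R[n]}]_q) : Prop :=
  [/\ P^T = P, mxdeg_le (2 * d) P &
      exists (s : nat) (M : 'M[{mpoly R[n]}]_(s, q)),
        mxdeg_le d M /\ P = M^T *m M].

End SOS.

Section Monomials.
Variables (n d : nat).

(* All exponents of total degree at most d, in the order                      *)
(* 1, x_1, ..., x_n, x_1^2, x_1 x_2, ..., x_n^d: by increasing degree and,    *)
(* within a degree, from the largest exponent to the smallest (the order of   *)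
(* 'X_{1..n} is lexicographic on exponents of equal degree).                  *)
Definition monomials : seq 'X_{1..n} :=
  sort (fun m1 m2 => (mdeg m1 < mdeg m2)%N
                     || (mdeg m1 == mdeg m2) && (m2 <= m1)%O)
       [seq bmnm m | m : 'X_{1..n < d.+1}].

Lemma mem_monomials (m : 'X_{1..n}) : (m \in monomials) = (mdeg m <= d)%N.
Proof.
rewrite mem_sort; apply/imageP/idP => [[x _ ->]|le_md].
  by rewrite -ltnS bmdeg.
by exists (BMultinom (le_md : (mdeg m < d.+1)%N)).
Qed.

Lemma uniq_monomials : uniq monomials.
Proof. by rewrite sort_uniq map_inj_uniq ?enum_uniq //; apply: val_inj. Qed.

Lemma size_monomials : size monomials = 'C(n + d, d).
Proof.
rewrite size_sort size_map -cardT.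
rewrite -bin_sub ?leq_addl // addnK -card_partial_ord_partitions.
pose f (t : n.-tuple 'I_d.+1) : 'X_{1..n} := [multinom val (tnth t i) | i < n].
have degf t : mdeg (f t) = (\sum_(i <- t) i)%N.
  by rewrite mdegE big_tuple; apply: eq_bigr => i _; rewrite mnmE.
have injf : injective f.
  move=> s t /mnmP e; apply: eq_from_tnth => i; apply: val_inj.
  by have := e i; rewrite !mnmE.
set A := [set _ | _]; rewrite cardT -(size_map (@bmnm n d.+1)).
rewrite cardE -(size_map f); apply/perm_size/uniq_perm.
- by rewrite map_inj_uniq ?enum_uniq //; apply: val_inj.
- by rewrite map_inj_uniq ?enum_uniq.
move=> m; apply/mapP/mapP => [[x _ ->]|[t]].
  have le_xd i : (x i < d.+1)%N.
    by apply: leq_trans (bmdeg x); rewrite ltnS mdegE (bigD1 i) //= leq_addr.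
  pose t := [tuple Ordinal (le_xd i) | i < n].
  have ft : f t = x by apply/mnmP => i; rewrite mnmE tnth_mktuple.
  by exists t; rewrite // mem_enum inE -degf ft -ltnS bmdeg.
rewrite mem_enum inE -degf => le_td ->.
by exists (BMultinom (le_td : (mdeg (f t) < d.+1)%N)); rewrite ?mem_enum.
Qed.

End Monomials.

Section Gram.
Variables (R : realType) (n d : nat).

Local Notation N := 'C(n + d, d).

(* v_d(x) *)
Definition monomial_vec : 'cV[{mpoly R[n]}]_N :=
  \col_(i < N) 'X_[nth 0%MM (monomials n d) i].

(* I_q (x) v_d(x); the cast only identifies q * 1 with q. *)
Definition gram_basis (q : nat) : 'M[{mpoly R[n]}]_(q * N, q) :=
  castmx (erefl, muln1 q) (1%:M *t monomial_vec).

Definition psd_mx (m : nat) (Q : 'M[R]_m) : Prop :=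
  Q^T = Q /\ forall u : 'cV[R]_m, 0 <= (u^T *m Q *m u) 0 0.

Definition gram_mx (q : nat) (P : 'M[{mpoly R[n]}]_q) (Q : 'M[R]_(q * N)) :
    Prop :=
  psd_mx Q /\
  P = (gram_basis q)^T *m map_mx (@mpolyC n R) Q *m gram_basis q.

Definition gram_block (q : nat) (Q : 'M[R]_(q * N)) (i j : 'I_q) : 'M[R]_N :=
  \matrix_(a, b) Q (mxtens_index (i, a)) (mxtens_index (j, b)).

(* P is in Sigma_{n,2d}^r(E, 0) *)
Definition sparse_sos_mx (r : nat) (E : rel 'I_r) (P : 'M[{mpoly R[n]}]_r) :
    Prop :=
  sos_mx d P /\ forall i j, ~~ edge_star E i j -> P i j = 0 /\ P j i = 0.

(* P is in the set \tilde Sigma_{n,2d}^r(E, 0).  The zero entries p_ij that   *)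
(* constrain the Gram matrix are those imposed by E, i.e. the (i, j) outside  *)
(* E^*.  An entry inside the pattern that happens to vanish does not          *)
(* constrain Q; if it did, the set would not be the set of matrices that      *)
(* decompose over the maximal cliques.  For the complete graph on 3 nodes,    *)
(* the SOS matrix M^T M with M = [1 1 x; x 1 -1] has p_13 = 0, but no Gram    *)
(* matrix of it has a zero (1,3) block.                                       *)
Definition sparse_gram_sos_mx (r : nat) (E : rel 'I_r)
    (P : 'M[{mpoly R[n]}]_r) : Prop :=
  sparse_sos_mx E P /\
  exists Q : 'M[R]_(r * N),
    gram_mx P Q /\
    forall i j, ~~ edge_star E i j -> gram_block Q i j = 0.

End Gram.

(* Main.v *)
(* The key is Agler's theorem: a positive semidefinite matrix with chordal       *)
(* sparsity pattern is a sum of rank-one terms [u *m u^T], each [u] supported on *)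
(* a clique.  A chordal graph has a simplicial vertex (Dirac); eliminating one   *)
(* of its indices by a symmetric Gaussian step subtracts such a term and stays   *)
(* inside the pattern.  Applied to the Gram matrix, where index (i, a) inherits  *)
(* the neighbours of the node i, this writes P as a sum of [w^T *m w] with rows  *)
(* w of degree at most d supported on a clique; grouping the rows by a maximal   *)
(* clique gives the P_k.  Conversely the coefficients of the factors of the P_k  *)
(* give a Gram matrix with the right zero blocks.                                *)

Require Import Defs.
From mathcomp Require Import all_boot all_order all_algebra.
From mathcomp Require Import reals.
From mathcomp Require Import mpoly mxtens.
From mathcomp Require Import ring.

Set Implicit Arguments.
Unset Strict Implicit.
Unset Printing Implicit Defensive.

Import Order.TTheory GRing.Theory Num.Theory.
Local Open Scope ring_scope.

(** A Gram matrix reduces the claim to real matrices. If Q is a sum of terms u u^T, then P is the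
    sum of the w^T w with w = u^T (I ⊗ v_d) ([gram_outer]), and w is supported on a clique as soon
    as u is supported over it. Such a splitting of Q exists by [psd_clique_sum]: pivoting at an
    index whose neighbours lie in a clique alters Q only on the block of that clique, and
    [chordal_simplicial] provides such an index in every remaining set. A row w supported on C
    factors through E_C ([index_mx_proj]).

    Conversely, [coef_mxK] recovers a polynomial matrix of degree at most d from its coefficients,
    so a factor with clique-supported rows yields a Gram matrix with the prescribed zero blocks
    ([sparse_gram_sos_mx_outer]), and these matrices add up. *)

(** * Successors in a cyclic sequence *)

Section NextCycle.
Variable T : eqType.

(** Used to rule out a chord that cuts off nothing: its ends would be consecutive on the cycle. *)
Lemma next_cons_cat_last (v b y : T) (q1 q2 : seq T) :
  uniq (v :: b :: q1 ++ y :: q2) ->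
  next (v :: b :: q1 ++ y :: q2) (last b q1) = y.
Proof.
have -> : v :: b :: q1 ++ y :: q2 = (v :: belast b q1) ++ last b q1 :: y :: q2.
  by rewrite -[in RHS]cat_rcons rcons_cons -lastI.
move=> Up; rewrite next_nth mem_cat mem_head orbT.
rewrite index_cat ifN; last first.
  by move: Up; rewrite cat_uniq => /and3P[_ /norP[]].
by rewrite /= eqxx addn0 /= nth_cat size_belast ltnNge leqnSn /= subSnn.
Qed.

Lemma next_cons_last (v b : T) (q : seq T) :
  uniq (v :: b :: q) -> next (v :: b :: q) (last b q) = v.
Proof.
rewrite (lastI b q); set p := belast b q; set z := last b q => Up.
have zp : z \notin v :: p.
  by move: Up; rewrite -cats1 -cat_cons cat_uniq /= orbF => /and3P[].
rewrite next_nth in_cons mem_rcons mem_head orbT /=.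
have -> : (v == z) = false by apply: contraNF zp => /eqP->; apply: mem_head.
rewrite nth_default // -cats1 index_cat size_cat addn1 ifN /= ?eqxx ?addn0 //.
by move: zp; rewrite inE => /norP[].
Qed.

End NextCycle.

(** * Simplicial vertices of chordal graphs *)

Section ChordalGraph.
Variables (r : nat) (E : rel 'I_r).
Hypotheses (symE : ssrbool.symmetric E) (chordalE : chordal E).

Local Notation T := (edge_star E).

Lemma edge_star_refl : reflexive T.
Proof. by move=> x; rewrite /edge_star /= eqxx. Qed.

Lemma edge_star_sym : ssrbool.symmetric T.
Proof. by move=> x y; rewrite /edge_star /= eq_sym symE. Qed.

(* A path from [b] to [b'] through non-neighbours of [v] closes up, through [v], *)
(* to a cycle whose chords only serve to shorten the path. *)
Lemma chordal_bridge (v b b' : 'I_r) (q : seq 'I_r) :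
  path E b q -> last b q = b' ->
  {in q, forall z, z = b' \/ ~~ T v z} ->
  E v b -> E v b' -> v != b -> v != b' -> T b b'.
Proof.
have [k] := ubnP (size q); elim: k q => // k IHk q0 ltk pq0 lq0 Dq0.
move=> Evb Evb' vNb vNb'; rewrite /edge_star /=.
have [//|bNb' /=] := eqVneq b b'.
case: (shortenP pq0) lq0 => q pq Uq sub_q lq.
have lek : (size q <= k)%N.
  by rewrite -ltnS (leq_ltn_trans _ ltk) // uniq_leq_size //; case/andP: Uq.
have Dq : {in q, forall z, z = b' \/ ~~ T v z} by move=> z /sub_q /Dq0.
have vq : v \notin q.
  apply/negP => /Dq[vb'|]; first by rewrite vb' eqxx in vNb'.
  by rewrite edge_star_refl.
(* A strictly shorter path through nodes of [q] meets the same conditions, so induction settles the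
   claim. *)
have short q1 q2 y : subseq (q1 ++ y :: q2) q ->
    (size (q1 ++ y :: q2) < size q)%N ->
    path E b (q1 ++ y :: q2) -> last y q2 = b' -> E b b'.
  move=> /mem_subseq sub lt_q pth lst.
  have := IHk (q1 ++ y :: q2) (leq_trans lt_q lek) pth.
  rewrite last_cat => /(_ lst (fun z zq => Dq z (sub z zq)) Evb Evb' vNb vNb').
  by case/orP=> // /eqP bb'; rewrite bb' eqxx in bNb'.
case sq: q => [|y1 [|y2 q']].
- by move: lq bNb'; rewrite sq /= => ->; rewrite eqxx.
- by move: pq lq; rewrite sq /= andbT => ? <-.
pose c := v :: b :: q; have Uc : uniq c.
  by rewrite /c cons_uniq inE negb_or vNb vq.
have cycE : cycle E c by rewrite /c /= Evb rcons_path pq lq symE.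
have /chordalE[] : ucycle E c by rewrite /ucycle cycE.
  by rewrite /c sq.
have lb' : last b q = b' by [].
(* A chord between two nodes of the path bypasses the segment between them, which is nonempty since
   they are not consecutive. The cases are [y] after [x] and [y] before [x]. *)
have split_chord x y : x \in b :: q -> y \in q -> x != y -> E x y ->
    next c x != y -> next c y != x -> E b b'.
  move: (Uc); rewrite /c => Uq' xq yq xNy Exy nxy nyx.
  case: (splitPl xq) pq lq Uq' nxy nyx yq short => q1 q2 lx.
  rewrite cat_path last_cat lx => /andP[pq1 pq2] lq Uq' nxy nyx yq short.
  move: yq; rewrite mem_cat => /orP[yq1|yq2]; last first.
    case/splitPr: yq2 pq2 lq Uq' nxy short => q21 q22.
    case: q21 => [|z q21] pq2 lq Uq' nxy short.
      by move: nxy; rewrite -lx next_cons_cat_last ?eqxx.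
    move: pq2; rewrite cat_path /= => /and3P[_ _ pq22].
    apply: (short q1 q22 y).
    - rewrite cat_subseq // -[z :: _]/([:: z] ++ _).
      by rewrite -[y :: q22]cat0s cat_subseq ?sub0seq // -[y :: q22]cat0s
                 cat_subseq ?sub0seq.
    - by rewrite !size_cat ltn_add2l -[X in (X < _)%N]add0n ltn_add2r.
    - by rewrite cat_path pq1 lx /= Exy.
    - by move: lq; rewrite last_cat.
  have yq1' : y \in b :: q1 by rewrite inE yq1 orbT.
  case: (splitPl yq1') pq1 lx lq Uq' nyx short {yq1} => q11 q12 ly.
  rewrite cat_path last_cat ly => /andP[pq11 pq12].
  case/lastP: q12 pq12 => [|q12 x'] pq12; rewrite ?last_rcons.
    by move=> /= yx; rewrite yx eqxx in xNy.
  move=> xx'; rewrite {x'}xx' in pq12 *; rewrite -catA cat_rcons => lq Uq' nyx short.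
  case: q12 pq12 Uq' nyx short => [|z q12] pq12 Uq' nyx short.
    by move: nyx; rewrite -ly next_cons_cat_last ?eqxx.
  apply: (short q11 q2 x) => //.
  - rewrite cat_subseq // -[x :: q2]cat0s.
    by rewrite cat_subseq ?sub0seq.
  - by rewrite !size_cat ltn_add2l -[X in (X < _)%N]add0n ltn_add2r.
  - by rewrite cat_path pq11 ly /= symE Exy.
have next_v : next c v = b by rewrite /c /= eqxx.
have next_b' : next c b' = v by rewrite -lb' next_cons_last.
(* On the cycle, [v] is adjacent only to [b] and [b'], both consecutive to it, so no chord ends at
   [v]. *)
have nochord_v y : y \in c -> v != y -> next c v != y -> next c y != v -> E v y ->
    False.
  rewrite next_v inE eq_sym => /orP[/eqP->|]; first by rewrite eqxx.
  rewrite inE eq_sym => /orP[/eqP->|yq]; first by rewrite eqxx.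
  move=> _ _; case: (Dq y yq) => [->|]; first by rewrite next_b' eqxx.
  by rewrite negb_or => /andP[_ /negPf->].
move=> x [y /and5P[xc yc xNy nxy /andP[nyx Exy]]].
move: (xc) (yc); rewrite !(in_cons v).
have [xv|_ /=] := eqVneq x v; first by subst x; case: (nochord_v y).
have [yv|_ /=] := eqVneq y v.
  by subst y; case: (nochord_v x) => //; rewrite 1?eq_sym // symE.
move=> xq yq; move: (yq); rewrite inE => /orP[/eqP yb|yq']; last first.
  exact: (split_chord x y).
subst y; move: xq; rewrite inE (negPf xNy) /= => xq.
by apply: (split_chord b x); rewrite // 1?eq_sym // symE.
Qed.

(** Relative to a vertex set [S], because elimination passes to induced subgraphs. *)
Definition simplicial (S : {set 'I_r}) (w : 'I_r) :=
  {in S &, forall x y, T w x -> T w y -> T x y}.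

(* [B] is the boundary of a component [D] of the non-neighbours of [v]; it is a  *)
(* clique, and a vertex of [D] simplicial in [D :|: B] is simplicial in [S].     *)
Lemma dirac_strong (S : {set 'I_r}) (v a : 'I_r) :
  v \in S -> a \in S -> ~~ T v a ->
  exists w, [/\ w \in S, ~~ T v w & simplicial S w].
Proof.
have [k] := ubnP #|S|; elim: k S v a => // k IHk S v a ltk vS aS vNa.
have weak (S' : {set 'I_r}) : (#|S'| < k)%N -> S' != set0 ->
    exists2 w, w \in S' & simplicial S' w.
  move=> ltS' /set0Pn[z zS'].
  case: (boolP [exists x in S', exists y in S', ~~ T x y]) => [|cl].
    case/exists_inP=> x xS' /exists_inP[y yS' xNy].
    by have [w [wS' _ sw]] := IHk S' x y ltS' xS' yS' xNy; exists w.
  exists z => // x y xS' yS' _ _; apply: contraR cl => xNy.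
  by apply/exists_inP; exists x => //; apply/exists_inP; exists y.
pose A := [set x in S | ~~ T v x].
pose eA := [rel x y | [&& E x y, x \in A & y \in A]].
have symA : connect_sym eA.
  by apply: sym_connect_sym => x y; rewrite /= symE [(x \in A) && _]andbC.
pose D := [set x | connect eA a x].
have aA : a \in A by rewrite inE aS.
have DA x : x \in D -> x \in A.
  rewrite inE => /connectP[q]; case/lastP: q => [_ -> //|q y].
  by rewrite rcons_path last_rcons => /andP[_ /and3P[_ _ ?]] ->.
pose B := [set b in S | (b \notin D) && [exists d in D, E d b]].
have nbr w x : w \in D -> x \in S -> T w x -> x \in D :|: B.
  move=> wD xS /orP[/eqP<-|Ewx]; first by rewrite inE wD.
  rewrite !inE xS; case: (connect eA a x) => //=.
  by apply/exists_inP; exists w.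
(* A boundary vertex not adjacent to [v] would lie in [A], next to [D], and so belong to the
   component [D]. *)
have EvB b : b \in B -> E v b && (v != b).
  rewrite inE => /and3P[bS bD /exists_inP[d dD Edb]].
  have dA := DA d dD.
  have vNb : v != b.
    apply/eqP => vb; move: dA; rewrite inE => /andP[_].
    by rewrite vb edge_star_sym /edge_star /= Edb orbT.
  rewrite vNb andbT; apply: contraR bD => vEb.
  have bA : b \in A by rewrite inE bS /edge_star /= (negPf vNb).
  move: dD; rewrite !inE => /connect_trans; apply; apply: connect1.
  by rewrite /= Edb dA.
(* Two boundary vertices are joined by a path through [D], which avoids the neighbours of [v]. *)
have clB : {in B &, forall b b', T b b'}.
  move=> b b' bB b'B; have /andP[Evb vNb] := EvB b bB.
  have /andP[Evb' vNb'] := EvB b' b'B.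
  have [_ _ /exists_inP[d dD Edb]] : [/\ b \in S, b \notin D & [exists d in D, E d b]].
    by move: bB; rewrite inE => /and3P.
  have [_ _ /exists_inP[d' d'D Edb']] :
      [/\ b' \in S, b' \notin D & [exists d in D, E d b']].
    by move: b'B; rewrite inE => /and3P.
  have /connectP[q pq lq] : connect eA d d'.
    move: dD d'D; rewrite !inE => ad ad'.
    by apply: connect_trans ad'; rewrite symA.
  apply: (@chordal_bridge v b b' (d :: rcons q b')) => //.
  - rewrite /= symE Edb rcons_path -lq Edb' andbT.
    by apply: sub_path pq => x y /= /and3P[].
  - by rewrite /= last_rcons.
  move=> z; rewrite inE mem_rcons inE => /or3P[/eqP->|/eqP->|zq].
  - by right; have:= DA d dD; rewrite inE => /andP[].
  - by left.
  right; have: z \in A; last by rewrite inE => /andP[].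
  have : all (mem A) q.
    elim: q d pq {lq zq dD Edb} => //= x q IHq d /andP[/and3P[_ _ ->]] /=.
    exact: IHq.
  by move/allP/(_ z zq).
have lift w : w \in D -> simplicial (D :|: B) w ->
    exists w, [/\ w \in S, ~~ T v w & simplicial S w].
  move=> wD sw; have:= DA w wD; rewrite inE => /andP[wS vw].
  exists w; split=> // x y xS yS wx wy.
  by apply: sw => //; apply: nbr wD _ _.
have aD : a \in D by rewrite inE connect0.
have ltDB : (#|D :|: B| < k)%N.
  rewrite -ltnS (leq_trans _ ltk) // ltnS proper_card //; apply/properP; split.
    apply/subsetP => x; rewrite inE => /orP[/DA|]; rewrite inE => /andP[] //.
  exists v => //; rewrite inE; apply/norP; split.
    by apply/negP => /DA; rewrite inE edge_star_refl andbF.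
  by apply/negP => /EvB; rewrite eqxx andbF.
(* If some [b] in [B] misses a vertex of [D :|: B], induction gives a simplicial vertex not adjacent
   to [b], hence outside the clique [B]. Otherwise every vertex of [B] is adjacent to all of
   [D :|: B], and a simplicial vertex of [D] suffices. *)
case: (boolP [exists b in B, exists y in D :|: B, ~~ T b y]) => [|univ].
  case/exists_inP=> b bB /exists_inP[y yDB bNy].
  have bDB : b \in D :|: B by rewrite inE bB orbT.
  have [w [wDB bNw sw]] := IHk _ b y ltDB bDB yDB bNy.
  apply: (lift w) => //; move: wDB; rewrite inE => /orP[//|wB].
  by rewrite clB in bNw.
have univB b y : b \in B -> y \in D :|: B -> T b y.
  move=> bB yDB; apply: contraR univ => bNy.
  by apply/exists_inP; exists b => //; apply/exists_inP; exists y.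
have [||w wD sw] := weak D.
- by rewrite (leq_ltn_trans _ ltDB) // subset_leq_card // subsetUl.
- by apply/set0Pn; exists a.
apply: (lift w) => // x y xDB yDB wx wy.
move: (xDB); rewrite inE => /orP[xD|xB]; last exact: univB.
move: (yDB); rewrite inE => /orP[yD|yB]; last first.
  by rewrite edge_star_sym; apply: univB.
exact: sw.
Qed.

Lemma chordal_simplicial (S : {set 'I_r}) :
  S != set0 -> exists2 w, w \in S & simplicial S w.
Proof.
move=> /set0Pn[z zS].
case: (boolP [exists x in S, exists y in S, ~~ T x y]) => [|cl].
  case/exists_inP=> x xS /exists_inP[y yS xNy].
  by have [w [wS _ sw]] := dirac_strong xS yS xNy; exists w.
exists z => // x y xS yS _ _; apply: contraR cl => xNy.
by apply/exists_inP; exists x => //; apply/exists_inP; exists y.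
Qed.

Lemma cliqueP (S : {set 'I_r}) : reflect {in S &, forall x y, T x y} (clique E S).
Proof.
apply: (iffP forall_inP) => [cl x y xS yS | cl x xS].
  by have /forall_inP/(_ y yS) := cl x xS; rewrite /= implyNb.
by apply/forall_inP => y yS; rewrite implyNb; apply: cl.
Qed.

End ChordalGraph.

(** * Elimination in positive semidefinite matrices *)

Section PSD.
Variables (R : realType) (m : nat).
Implicit Types Q : 'M[R]_m.

Lemma quad_shift Q (x : 'cV[R]_m) (p : 'I_m) (c : R) : Q^T = Q ->
  let y := x + c *: delta_mx p 0 in
  (y^T *m Q *m y) 0 0 =
    (x^T *m Q *m x) 0 0 + 2 * c * (Q *m x) p 0 + c ^+ 2 * Q p p.
Proof.
move=> symQ /=; set e : 'cV[R]_m := delta_mx p 0.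
have dl (z : 'cV[R]_m) : (e^T *m z) 0 0 = z p 0.
  by rewrite trmx_delta -rowE mxE.
have dr : (x^T *m (Q *m e)) 0 0 = (Q *m x) p 0.
  have -> : x^T *m (Q *m e) = (e^T *m (Q *m x))^T.
    by rewrite !trmx_mul trmxK symQ mulmxA.
  by rewrite mxE dl.
have dd : (e^T *m (Q *m e)) 0 0 = Q p p by rewrite dl -colE mxE.
have -> : (x + c *: e)^T *m Q *m (x + c *: e) =
    x^T *m Q *m x + c *: (x^T *m (Q *m e)) + c *: (e^T *m (Q *m x))
    + (c ^+ 2) *: (e^T *m (Q *m e)).
  have -> : (x + c *: e)^T = x^T + c *: e^T by rewrite linearD linearZ.
  rewrite -!mulmxA !mulmxDr !mulmxDl -!scalemxAr -!scalemxAl.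
  by rewrite scalerA -expr2 !addrA; congr (_ + _); rewrite addrAC.
have addE (A B : 'M[R]_1) : (A + B) 0 0 = A 0 0 + B 0 0 by rewrite mxE.
have sclE a (A : 'M[R]_1) : (a *: A) 0 0 = a * A 0 0 by rewrite mxE.
by rewrite !addE !sclE dl dr dd; ring.
Qed.

Lemma psd_diag_ge0 Q p : psd_mx Q -> 0 <= Q p p.
Proof.
move=> [_ /(_ (delta_mx p 0))].
by rewrite trmx_delta -rowE -colE !mxE.
Qed.

(** With a zero diagonal entry the form is affine along the p-th axis, so nonnegativity forces slope
    zero. *)
Lemma psd_diag0 Q p i : psd_mx Q -> Q p p = 0 -> Q p i = 0.
Proof.
move=> [symQ psdQ] Qpp; apply/eqP/negPn/negP => Qpi.
(* The coefficient is chosen to make the value of the form -1. *)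
have := psdQ (delta_mx i 0 + (- (Q i i + 1) / (2 * Q p i)) *: delta_mx p 0).
rewrite quad_shift // Qpp trmx_delta -rowE -!colE !mxE.
have -> : Q i i + 2 * (- (Q i i + 1) / (2 * Q p i)) * Q p i +
    (- (Q i i + 1) / (2 * Q p i)) ^+ 2 * 0 = -1 by field.
by rewrite ler0N1.
Qed.

(* The junk value 0^-1 = 0 covers a zero pivot, where row [p] vanishes anyway. *)
Definition pivot_vec Q p : 'cV[R]_m := Num.sqrt (Q p p)^-1 *: col p Q.

Lemma pivot_outerE Q p i j : psd_mx Q ->
  (pivot_vec Q p *m (pivot_vec Q p)^T) i j = (Q p p)^-1 * Q i p * Q j p.
Proof.
move=> psdQ; rewrite mxE big_ord1 !mxE mulrACA -expr2 sqr_sqrtr ?mulrA //.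
by rewrite invr_ge0 psd_diag_ge0.
Qed.

Lemma pivot_clear Q p i : psd_mx Q ->
  (Q - pivot_vec Q p *m (pivot_vec Q p)^T) p i = 0.
Proof.
move=> psdQ; have symQ := psdQ.1; rewrite mxE [X in _ + X]mxE pivot_outerE //.
have -> : Q i p = Q p i by rewrite -[in LHS]symQ mxE.
have [Qpp|Qpp] := eqVneq (Q p p) 0; last by rewrite mulVf // mul1r subrr.
by rewrite (psd_diag0 i psdQ Qpp) mulr0 subrr.
Qed.

Lemma pivot_psd Q p : psd_mx Q ->
  psd_mx (Q - pivot_vec Q p *m (pivot_vec Q p)^T).
Proof.
move=> psdQ; have [symQ posQ] := psdQ; split.
  by rewrite linearB /= trmx_mul trmxK symQ.
move=> x; set u := pivot_vec Q p.
have ux : (u^T *m x) 0 0 = Num.sqrt (Q p p)^-1 * (Q *m x) p 0.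
  rewrite linearZ /= -scalemxAl mxE; congr (_ * _).
  by rewrite tr_col symQ -row_mul mxE.
have uxx : (x^T *m (u *m u^T) *m x) 0 0 = (Q p p)^-1 * (Q *m x) p 0 ^+ 2.
  rewrite mulmxA -mulmxA -[x^T *m u]trmxK trmx_mul trmxK.
  rewrite mxE big_ord1 [X in X * _]mxE ux -expr2 exprMn sqr_sqrtr //.
  by rewrite invr_ge0 psd_diag_ge0.
rewrite mulmxBr mulmxBl mxE [X in _ + X]mxE uxx.
(* For a nonzero pivot, this shift minimises the form of [Q] along the p-th axis, and the minimum is
   the value of the reduced form at [x]. For a zero pivot the shift is 0 and the two forms agree. *)
have := posQ (x + (- (Q p p)^-1 * (Q *m x) p 0) *: delta_mx p 0).
rewrite quad_shift //; congr (_ <= _).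
have [Qpp|Qpp] := eqVneq (Q p p) 0; first by rewrite Qpp invr0; ring.
by field.
Qed.

(** [K] labels the cliques. The indices are abstract because those of a Gram matrix are pairs of a
    node and a monomial; [elim_T] is the perfect elimination property. *)
Variables (K : eqType) (clq : K -> pred 'I_m) (T : rel 'I_m).
Hypothesis symT : ssrbool.symmetric T.
Hypothesis clq_T : forall k x y, clq k x -> clq k y -> T x y.
Hypothesis elim_T : forall S : {set 'I_m}, S != set0 ->
  exists2 p, p \in S & exists k, {in S, forall x, T p x -> clq k x}.

(* Symmetric Gaussian elimination along a perfect elimination ordering creates *)
(* no fill-in. *)
Lemma psd_clique_sum Q : psd_mx Q -> (forall i j, ~~ T i j -> Q i j = 0) ->
  exists2 l : seq (K * 'cV[R]_m), Q = \sum_(w <- l) w.2 *m w.2^T &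
    forall w i, w \in l -> w.2 i 0 != 0 -> clq w.1 i.
Proof.
move=> psdQ patQ.
have [S supp] : exists S : {set 'I_m},
    forall i j, Q i j != 0 -> (i \in S) && (j \in S).
  by exists setT => i j; rewrite !in_setT.
have [k] := ubnP #|S|; elim: k S Q psdQ patQ supp => // k IHk S Q psdQ patQ supp ltk.
have symQ i j : Q i j = Q j i by rewrite -[in LHS]psdQ.1 mxE.
have [S0|/elim_T[p pS [c cP]]] := eqVneq S set0.
  exists [::]; last by [].
  rewrite big_nil; apply/matrixP => i j; rewrite mxE.
  by apply/eqP; apply: contraTT isT => /supp; rewrite S0 inE.
set u := pivot_vec Q p.
have uc i : u i 0 != 0 -> clq c i.
  rewrite !mxE mulf_eq0 => /norP[_ Qip].
  have /andP[iS _] := supp _ _ Qip; apply: cP => //.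
  by rewrite symT; apply: contraR Qip => /patQ->.
have uu i j : (u *m u^T) i j = u i 0 * u j 0 by rewrite mxE big_ord1 [u^T 0 j]mxE.
have [||i j||l defQ lP] := IHk (S :\ p) (Q - u *m u^T).
- exact: pivot_psd.
(* No fill-in: the subtracted term is nonzero only where both indices lie in the clique [c]. *)
- move=> i j nT; rewrite mxE [X in _ + X]mxE uu patQ // sub0r.
  apply/eqP; rewrite oppr_eq0; apply: contraR nT.
  by rewrite mulf_eq0 => /norP[/uc ci /uc cj]; apply: clq_T ci cj.
- move=> nz; rewrite !inE -!andbA.
  have psdQ' : psd_mx (Q - u *m u^T) by apply: pivot_psd.
  have -> /= : i != p by apply: contraNneq nz => ->; rewrite pivot_clear.
  have -> /= : j != p.
    by apply: contraNneq nz => ->; rewrite -psdQ'.1 mxE pivot_clear.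
  rewrite andbC; apply: contraR nz => nS.
  have Qij a b : ~~ ((a \in S) && (b \in S)) -> Q a b = 0.
    by move=> n; apply/eqP; apply: contraR n => /supp.
  rewrite mxE [X in _ + X]mxE pivot_outerE // (Qij i j); last by rewrite andbC.
  move: nS; rewrite negb_and => /orP[/negPf nj|/negPf ni].
    by rewrite (Qij j p) ?nj // mulr0 subr0.
  by rewrite (Qij i p) ?ni // mulr0 mul0r subr0.
- by rewrite -ltnS (leq_trans _ ltk) // ltnS [in X in (_ < X)%N](cardsD1 p) pS.
exists ((c, u) :: l); first by rewrite big_cons /= -defQ addrC subrK.
by move=> w i; rewrite inE => /predU1P[->|/lP]; [apply: uc | apply].
Qed.

End PSD.

(** * Sums of SOS and of positive semidefinite matrices *)

Section SOSClosure.
Variables (R : realType) (n d : nat).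
Implicit Types q s : nat.

Lemma sos_mx_outer q s (M : 'M[{mpoly R[n]}]_(s, q)) :
  mxdeg_le d M -> sos_mx d (M^T *m M).
Proof.
move=> degM; split; first by rewrite trmx_mul trmxK.
  move=> i j; rewrite mxE; apply: leq_trans (msize_sum _ _ _) _.
  apply/bigmax_leqP => k _; rewrite mxE.
  have [->|nz1] := eqVneq (M k i) 0; first by rewrite mul0r msize0.
  have [->|nz2] := eqVneq (M k j) 0; first by rewrite mulr0 msize0.
  (* [msize] is the degree plus one, so sizes of nonzero factors add up to one too many. *)
  rewrite msizeM // mul2n -addnn -addSn -ltnS prednK; last first.
    by rewrite addn_gt0 lt0n msize_poly_eq0 nz1.
  by rewrite -addnS leq_add.
by exists s, M.
Qed.

Lemma sos_mx0 q : sos_mx d (0 : 'M[{mpoly R[n]}]_q).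
Proof.
have <- : (0 : 'M_(0, q))^T *m (0 : 'M_(0, q)) = 0 :> 'M[{mpoly R[n]}]_q.
  by rewrite mulmx0.
by apply: sos_mx_outer => -[].
Qed.

Lemma sos_mxD q (P1 P2 : 'M[{mpoly R[n]}]_q) :
  sos_mx d P1 -> sos_mx d P2 -> sos_mx d (P1 + P2).
Proof.
move=> [_ _ [s1 [M1 [deg1 ->]]]] [_ _ [s2 [M2 [deg2 ->]]]].
rewrite -mul_row_col -tr_col_mx; apply: sos_mx_outer => i j.
by rewrite mxE; case: split => k.
Qed.

Lemma psd_outer m s (U : 'M[R]_(s, m)) : psd_mx (U^T *m U).
Proof.
split=> [|u]; first by rewrite trmx_mul trmxK.
rewrite mulmxA -mulmxA -trmx_mul mxE.
by apply: sumr_ge0 => k _; rewrite [X in X * _]mxE -expr2 sqr_ge0.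
Qed.

Lemma psdD m (Q1 Q2 : 'M[R]_m) : psd_mx Q1 -> psd_mx Q2 -> psd_mx (Q1 + Q2).
Proof.
move=> [s1 p1] [s2 p2]; split=> [|u]; first by rewrite linearD /= s1 s2.
by rewrite mulmxDr mulmxDl mxE addr_ge0.
Qed.

End SOSClosure.

(** * Gram matrices and polynomial coefficients *)

Section GramBasis.
Variables (R : realType) (n d : nat).
Local Notation N := 'C(n + d, d).
Local Notation mon := (nth 0%MM (monomials n d)).
Local Notation B q := (@gram_basis R n d q).
Local Notation polyU U := (map_mx (@mpolyC n R) U).

Lemma gram_basisE q (i j : 'I_q) (a : 'I_N) :
  B q (mxtens_index (i, a)) j = (i == j)%:R * 'X_[mon a].
Proof.
rewrite castmxE /= cast_ord_id.
have -> : cast_ord (esym (muln1 q)) j = mxtens_index (j, ord0).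
  by apply: val_inj; rewrite /= muln1 addn0.
by rewrite tensmxE !mxE.
Qed.

Lemma mul_gram_basisE s q (U : 'M[R]_(s, q * N)) l j :
  (polyU U *m B q) l j = \sum_(a < N) U l (mxtens_index (j, a)) *: 'X_[mon a].
Proof.
transitivity (\sum_i \sum_a polyU U l (mxtens_index (i, a)) *
                             B q (mxtens_index (i, a)) j).
  rewrite mxE pair_big (reindex (@mxtens_index q N)) /=.
    by apply: eq_bigr => -[].
  by exists (@mxtens_unindex q N) => k; rewrite (mxtens_indexK, mxtens_unindexK).
rewrite (bigD1 j) //= [X in _ + X]big1 ?addr0 => [|i iNj].
  by apply: eq_bigr => a _; rewrite gram_basisE eqxx mul1r mxE mul_mpolyC.
by apply: big1 => a _; rewrite gram_basisE (negPf iNj) mul0r mulr0.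
Qed.

Lemma mxdeg_le_mul_gram_basis s q (U : 'M[R]_(s, q * N)) :
  mxdeg_le d (polyU U *m B q).
Proof.
move=> l j; rewrite mul_gram_basisE.
apply: leq_trans (msize_sum _ _ _) _; apply/bigmax_leqP => a _.
apply: leq_trans (msizeZ_le _ _) _; rewrite msizeX ltnS -mem_monomials.
by rewrite mem_nth ?size_monomials.
Qed.

Lemma gram_outer s q (U : 'M[R]_(s, q * N)) :
  (B q)^T *m polyU (U^T *m U) *m B q = (polyU U *m B q)^T *m (polyU U *m B q).
Proof. by rewrite map_mxM -map_trmx trmx_mul !mulmxA. Qed.

Definition coef_mx s q (M : 'M[{mpoly R[n]}]_(s, q)) : 'M[R]_(s, q * N) :=
  \matrix_(l, k) (M l (mxtens_unindex k).1)@_(mon (mxtens_unindex k).2).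

(** [monomials] lists each exponent of degree at most d exactly once, so no coefficient is lost or
    repeated. *)
Lemma coef_mxK s q (M : 'M[{mpoly R[n]}]_(s, q)) :
  mxdeg_le d M -> polyU (coef_mx M) *m B q = M.
Proof.
move=> degM; apply/matrixP => l j; rewrite mul_gram_basisE.
under eq_bigr => a _ do rewrite mxE mxtens_indexK /=.
set p := M l j.
have -> : \sum_(a < N) p@_(mon a) *: 'X_[mon a] =
    \sum_(m <- monomials n d) p@_m *: 'X_[m].
  by rewrite (big_nth 0%MM) size_monomials big_mkord.
apply/mpolyP => m; rewrite raddf_sum /=.
under eq_bigr => m' _ do rewrite mcoeffZ mcoeffX.
have [mon_m|nmon_m] := boolP (m \in monomials n d).
  rewrite (bigD1_seq m) ?uniq_monomials //= eqxx mulr1 big1 ?addr0 // => m' nm.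
  by rewrite (negPf nm) mulr0.
rewrite big_seq big1 => [|m' mon_m']; last first.
  have [mm'|_] := eqVneq m' m; last by rewrite mulr0.
  by rewrite -mm' mon_m' in nmon_m.
apply/esym/memN_msupp_eq0/msize_mdeg_ge; rewrite mem_monomials -ltnNge in nmon_m.
exact: leq_trans (degM l j) nmon_m.
Qed.

Lemma coef_mx_block0 s q (M : 'M[{mpoly R[n]}]_(s, q)) (i j : 'I_q) :
  (forall l, M l i = 0 \/ M l j = 0) ->
  gram_block ((coef_mx M)^T *m coef_mx M) i j = 0.
Proof.
move=> M0; apply/matrixP => a b; rewrite !mxE big1 // => l _.
rewrite !mxE !mxtens_indexK /=.
by case: (M0 l) => ->; rewrite mcoeff0 ?mul0r ?mulr0.
Qed.

End GramBasis.

(** * Sparse SOS matrices with a sparse Gram matrix *)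

Section SparseGramClosure.
Variables (R : realType) (n d r : nat) (E : rel 'I_r).

(** The zero blocks are prescribed by [E] alone, so they survive adding the Gram matrices. *)
Lemma sparse_gram_sos_mxD (P1 P2 : 'M[{mpoly R[n]}]_r) :
  sparse_gram_sos_mx d E P1 -> sparse_gram_sos_mx d E P2 ->
  sparse_gram_sos_mx d E (P1 + P2).
Proof.
move=> [[sos1 z1] [Q1 [[psd1 def1] b1]]] [[sos2 z2] [Q2 [[psd2 def2] b2]]].
split.
  split; first exact: sos_mxD.
  move=> i j nE; have [z1ij z1ji] := z1 i j nE; have [z2ij z2ji] := z2 i j nE.
  by rewrite !mxE z1ij z1ji z2ij z2ji addr0.
exists (Q1 + Q2); split.
  split; first exact: psdD.
  by rewrite [in LHS]def1 [in LHS]def2 map_mxD mulmxDr mulmxDl.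
move=> i j nE; have /matrixP e1 := b1 i j nE; have /matrixP e2 := b2 i j nE.
by apply/matrixP => a b; have := e1 a b; have := e2 a b;
   rewrite !mxE => -> ->; rewrite addr0.
Qed.

Lemma sparse_gram_sos_mx_outer s (W : 'M[{mpoly R[n]}]_(s, r)) :
  mxdeg_le d W ->
  (forall i j l, ~~ edge_star E i j -> W l i = 0 \/ W l j = 0) ->
  sparse_gram_sos_mx d E (W^T *m W).
Proof.
move=> degW patW; split.
  split=> [|i j nE]; first exact: sos_mx_outer.
  split; rewrite mxE big1 // => l _; rewrite mxE.
    by case: (patW i j l nE) => ->; rewrite ?mul0r ?mulr0.
  by case: (patW i j l nE) => ->; rewrite ?mul0r ?mulr0.
exists ((coef_mx d W)^T *m coef_mx d W); split.
  by split; [exact: psd_outer | rewrite gram_outer coef_mxK].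
by move=> i j nE; apply: coef_mx_block0 => l; apply: patW.
Qed.

Lemma sparse_gram_sos_mx0 : sparse_gram_sos_mx d E (0 : 'M[{mpoly R[n]}]_r).
Proof.
have <- : (0 : 'M_(0, r))^T *m (0 : 'M_(0, r)) = 0 :> 'M[{mpoly R[n]}]_r.
  by rewrite mulmx0.
by apply: sparse_gram_sos_mx_outer => [[]|? ? []].
Qed.

End SparseGramClosure.

(** * Restriction to a clique and extension by zero *)

Section IndexMatrix.
Variables (A : nzRingType) (r : nat) (C : {set 'I_r}).

Lemma mul_index_mxE s (M : 'M[A]_(s, #|C|)) l (k : 'I_#|C|) :
  (M *m index_mx A C) l (enum_val k) = M l k.
Proof.
rewrite mxE (bigD1 k) //= mxE eqxx mulr1 big1 ?addr0 // => k' k'k.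
by rewrite mxE (inj_eq enum_val_inj) (negPf k'k) mulr0.
Qed.

Lemma mul_index_mx0 s (M : 'M[A]_(s, #|C|)) l j :
  j \notin C -> (M *m index_mx A C) l j = 0.
Proof.
move=> jC; rewrite mxE big1 // => k _; rewrite mxE.
by case: eqP => [kj|_]; [rewrite -kj enum_valP in jC | rewrite mulr0].
Qed.

Lemma mul_tr_index_mxE s (W : 'M[A]_(s, r)) l (k : 'I_#|C|) :
  (W *m (index_mx A C)^T) l k = W l (enum_val k).
Proof.
rewrite mxE (bigD1 (enum_val k)) //= !mxE eqxx mulr1 big1 ?addr0 // => j jk.
by rewrite !mxE eq_sym (negPf jk) mulr0.
Qed.

(** E_C^T E_C is the coordinate projection onto the nodes of C. *)
Lemma index_mx_proj s (W : 'M[A]_(s, r)) :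
  (forall l j, j \notin C -> W l j = 0) ->
  W *m (index_mx A C)^T *m index_mx A C = W.
Proof.
move=> suppW; apply/matrixP => l j.
have [jC|jC] := boolP (j \in C); last by rewrite mul_index_mx0 // suppW.
by rewrite -(enum_rankK_in jC jC) mul_index_mxE mul_tr_index_mxE.
Qed.

End IndexMatrix.

Theorem theorem3 (R : realType) (n d r : nat) (E : rel 'I_r)
    (symE : ssrbool.symmetric E) (chordalE : chordal E)
    (t : nat) (C : 'I_t -> {set 'I_r}) (injC : injective C)
    (maxC : forall S : {set 'I_r},
              maximal_clique E S <-> exists k : 'I_t, C k = S)
    (P : 'M[{mpoly R[n]}]_r) :
  sparse_gram_sos_mx d E P <->
  exists Pk : forall k : 'I_t, 'M[{mpoly R[n]}]_#|C k|,
    (forall k : 'I_t, sos_mx d (Pk k)) /\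
    P = \sum_(k < t) (index_mx {mpoly R[n]} (C k))^T *m Pk k
                       *m index_mx {mpoly R[n]} (C k).
Proof.
have cliqueC k : clique E (C k).
  by have /maxsetP[] : maximal_clique E (C k) by apply/maxC; exists k.
split=> [[_ [Q [[psdQ defP] blockQ]]]|[Pk [sosPk ->]]]; last first.
  apply: (big_ind (sparse_gram_sos_mx d E)) => [|P1 P2|k _].
  - exact: sparse_gram_sos_mx0.
  - exact: sparse_gram_sos_mxD.
  have [_ _ [s [M [degM ->]]]] := sosPk k.
  (* With P_k = M^T M, the summand is W^T W for W = M E_C, whose rows vanish off the clique. *)
  rewrite !mulmxA -trmx_mul -mulmxA; apply: sparse_gram_sos_mx_outer => [l j|i j l].
    have [jC|jC] := boolP (j \in C k); last by rewrite mul_index_mx0 // msize0.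
    by rewrite -(enum_rankK_in jC jC) mul_index_mxE.
  have [iC|iC _] := boolP (i \in C k); last by left; rewrite mul_index_mx0.
  have [jC|jC _] := boolP (j \in C k); last by right; rewrite mul_index_mx0.
  by rewrite (cliqueP _ _ (cliqueC k)).
pose f (x : 'I_(r * 'C(n + d, d))) : 'I_r := (mxtens_unindex x).1.
have [|||x y Txy|l defQ suppl] :=
  @psd_clique_sum R _ _ (fun k x => f x \in C k)
    (fun x y => edge_star E (f x) (f y)) _ _ _ _ psdQ.
- by move=> x y; apply: edge_star_sym.
- by move=> k x y xC yC; apply: (cliqueP _ _ (cliqueC k)).
- move=> S /set0Pn[x0 x0S].
  have [|w /imsetP[p pS ->] sw] := @chordal_simplicial _ _ symE chordalE (f @: S).
    by apply/set0Pn; exists (f x0); apply: imset_f.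
  (* [p] lies over a simplicial node of [f @: S]. The neighbours of that node there form a clique
     [W], and a maximal clique containing [W] is the label. *)
  exists p => //; pose W := [set x in f @: S | edge_star E (f p) x].
  have /maxset_exists[M /maxC[k <-] /subsetP subW] : clique E W.
    by apply/cliqueP => x y; rewrite !inE => /andP[xS px] /andP[yS py]; apply: sw.
  by exists k => x xS px; apply: subW; rewrite inE imset_f.
- have /matrixP/(_ (mxtens_unindex x).2 (mxtens_unindex y).2) := blockQ _ _ Txy.
  by rewrite !mxE -!surjective_pairing !mxtens_unindexK.
pose row_of (w : 'I_t * 'cV[R]_(r * 'C(n + d, d))) :=
  map_mx (@mpolyC n R) w.2^T *m gram_basis R n d r.
pose V w := row_of w *m (index_mx {mpoly R[n]} (C w.1))^T.
have V_K w : w \in l -> V w *m index_mx _ (C w.1) = row_of w.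
  move=> wl; apply: index_mx_proj => i j jC; rewrite mul_gram_basisE big1 // => a _.
  rewrite mxE [i]ord1; have [->|nz] := eqVneq (w.2 (mxtens_index (j, a)) 0) 0.
    by rewrite scale0r.
  by have := suppl _ _ wl nz; rewrite /f mxtens_indexK /= (negPf jC).
(* A clique that labels no term receives the empty sum. *)
pose Pk k : 'M[{mpoly R[n]}]_#|C k| := \sum_(w <- l | w.1 == k)
  (row_of w *m (index_mx _ (C k))^T)^T *m (row_of w *m (index_mx _ (C k))^T).
exists Pk; split=> [k|].
  apply: (big_ind (@sos_mx R n d _)) => [|P1 P2|w _].
  - exact: sos_mx0.
  - exact: sos_mxD.
  apply: sos_mx_outer => i j; rewrite mul_tr_index_mxE.
  exact: mxdeg_le_mul_gram_basis.
have -> : P = \sum_(w <- l) (row_of w)^T *m row_of w.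
  rewrite defP defQ raddf_sum mulmx_sumr mulmx_suml /=.
  by apply: eq_bigr => w _; rewrite -gram_outer trmxK.
rewrite (partition_big (fun w => w.1) predT) //=; apply: eq_bigr => k _.
rewrite /Pk mulmx_sumr mulmx_suml big_seq_cond [RHS]big_seq_cond.
apply: eq_bigr => w /andP[wl /eqP wk]; rewrite -wk.
rewrite -[in LHS](V_K w wl).
by rewrite /V !trmx_mul !mulmxA.
Qed.
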